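(* Let $\omega=\{\gamma_{ij}\}_{0\le i+j\le 6}$ be complex numbers with $\overline{\gamma_{ij}}=\gamma_{ji}$ and $\gamma_{00}>0$, and let $M(\omega)(3)$ be the associated moment matrix. Assume that $M(\omega)(3)\ge0$ and that its columns satisfy $Z^3=-aZ-b\bar Z$, where $a,b\in\mathbb{R}$ and $b<a<2b$. Let $h(z,\bar z)=(z+\bar z)(z\bar z-b)$, and let $\gamma=\{\gamma_{ij}\}_{i,j\ge0}$ be the recursive doubly indexed sequence (RDIS) with initial conditions $\{\gamma_{ij}\}_{0\le i\le j\le2}$ (taken from $\omega$) and characteristic polynomial $P(z,\bar z)=z^3+az+b\bar z$. Then the following are equivalent: (i) there exists a representing measure for $\omega$; (ii) there exists a representing measure for $\gamma$; (iii) $\Lambda_\omega(h)=0$ and $\Lambda_\omega(zh)=0$; (iv) $\operatorname{Re}\gamma_{12}=b\operatorname{Re}\gamma_{01}$ and $\gamma_{22}=2b\operatorname{Re}\gamma_{20}+(a+b)\gamma_{11}$; (v) $h\in\mathcal{P}_\gamma$; (vi) the columns of $M(\omega)(3)$ satisfy $(Z+\bar Z)(Z\bar Z-b)=0$, i.e. $\bar ZZ^2+\bar Z^2Z-bZ-b\bar Z=0$.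
   Context: $M(\omega)(3)$ is the matrix with rows and columns indexed by the monomials $\bar z^iz^j$, $i+j\le3$, whose entry in row $\bar z^kz^l$, column $\bar z^iz^j$ is $\gamma_{i+l,j+k}$; its column indexed by $\bar z^iz^j$ is denoted $\bar Z^iZ^j$. $\ge0$ means positive semidefinite. $\Lambda_\omega$ is the linear functional on polynomials in $z,\bar z$ of total degree $\le6$ with $\Lambda_\omega(\bar z^iz^j)=\gamma_{ij}$. A representing measure for a (finite or infinite) family $\{\gamma_{ij}\}$ is a positive Borel measure $\mu$ on $\mathbb{C}$ with $\gamma_{ij}=\int\bar z^iz^j\,d\mu$ for all indices $(i,j)$ of the family. The RDIS with initial conditions $\{\gamma_{ij}\}_{0\le i\le j\le s-1}$ and characteristic polynomial $z^s-\sum_{0\le l+k\le s-1}a_{lk}\bar z^lz^k$ is the (unique) sequence $\{\gamma_{ij}\}_{i,j\ge0}$ having these initial values and satisfying $\gamma_{ji}=\overline{\gamma_{ij}}$ and $\gamma_{i,j+s}=\sum_{0\le l+k\le s-1}a_{lk}\gamma_{i+l,j+k}$ for all $i,j\ge0$. $\mathcal{P}_\gamma$ is the set of characteristic polynomials of $\gamma$: all $p=\sum p_{lk}\bar z^lz^k$ ($z,\bar z$ commuting indeterminates) with $\sum p_{lk}\gamma_{i+l,j+k}=0$ for all $i,j\ge0$. *)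

(* Defs.v *)
From HB Require Import structures.
From mathcomp Require Import all_boot all_order all_algebra.
From mathcomp Require Import complex polyXY.
From mathcomp Require Import all_classical all_reals all_analysis.

Set Implicit Arguments.
Unset Strict Implicit.
Unset Printing Implicit Defensive.

Import Order.TTheory GRing.Theory Num.Theory.
Import numFieldNormedType.Exports.

Local Open Scope classical_set_scope.
Local Open Scope ring_scope.
Local Open Scope sesquilinear_scope.

(* The complex plane is R[i] for R : realType.  A doubly indexed family is a  *)
(* function nat -> nat -> R[i]; a finite family {gamma_ij}_{i+j <= n} is such *)
(* a function of which only the values at i + j <= n are ever used.           *)
(* Polynomials in z and its conjugate zb (commuting indeterminates) are       *)
(* elements of {poly {poly R[i]}} with z := 'X and zb := 'Y = 'X%:P, so that  *)
(* p`_j`_i is the coefficient of zb^i z^j in p.                               *)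

Notation borelC R := (g_sigma_algebraType (@open (complex R : numFieldType))).

Section ComplexMoments.
Variable R : realType.
Implicit Types (mu : {measure set (borelC R) -> \bar R}) (f : borelC R -> R[i]).

Definition cintegrable mu f : Prop :=
  mu.-integrable setT (fun z => (complex.Re (f z))%:E) /\
  mu.-integrable setT (fun z => (complex.Im (f z))%:E).

Definition cintegral mu f : R[i] :=
  Complex (\int[mu]_z complex.Re (f z)) (\int[mu]_z complex.Im (f z)).

Definition monomial (i j : nat) : borelC R -> R[i] :=
  fun z => (z : R[i])^* ^+ i * (z : R[i]) ^+ j.

(* I is the index set of the family; integrability of the monomials is        *)
(* explicit because the integral is a total function.                         *)
Definition representing_measure (I : nat -> nat -> Prop)
    (gamma : nat -> nat -> R[i]) mu : Prop :=
  forall i j, I i j ->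
    cintegrable mu (monomial i j) /\ gamma i j = cintegral mu (monomial i j).

Definition mindex (d : nat) := {x : 'I_d.+1 * 'I_d.+1 | x.1 + x.2 <= d}%N.

Fact mindex_of_subproof d i j : (i + j <= d)%N ->
  ((inord i : 'I_d.+1) + (inord j : 'I_d.+1) <= d)%N.
Proof.
move=> ijd; rewrite !inordK //= ltnS; apply: leq_trans ijd.
  exact: leq_addl.
exact: leq_addr.
Qed.

Definition mindex_of d i j (ijd : (i + j <= d)%N) : mindex d :=
  exist _ (inord i, inord j) (mindex_of_subproof ijd).

Definition mindex_at d (r : 'I_#|{: mindex d}|) : 'I_d.+1 * 'I_d.+1 :=
  val (enum_val r).

Definition moment_mx (d : nat) (gamma : nat -> nat -> R[i]) :
    'M[R[i]]_#|{: mindex d}| :=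
  \matrix_(r < #|{: mindex d}|, c < #|{: mindex d}|)
    let: (k, l) := mindex_at r in let: (i, j) := mindex_at c in
    gamma (i + l)%N (j + k)%N.

Definition moment_col d gamma i j (ijd : (i + j <= d)%N) :
    'cV[R[i]]_#|{: mindex d}| :=
  col (enum_rank (mindex_of ijd)) (moment_mx d gamma).

(* 0 <= x in R[i] means that x is real and nonnegative, so that such an A is  *)
(* in particular Hermitian.                                                   *)
Definition psdmx n (A : 'M[R[i]]_n) : Prop :=
  forall v : 'cV[R[i]]_n, 0 <= (v ^t* *m A *m v) 0 0.

(* Meant for p of total degree at most n (other terms of p are ignored).      *)
Definition Lambda (n : nat) (omega : nat -> nat -> R[i])
    (p : {poly {poly R[i]}}) : R[i] :=
  \sum_(i < n.+1) \sum_(j < n.+1 | (i + j <= n)%N) p`_j`_i * omega i j.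

Definition charpolys (gamma : nat -> nat -> R[i]) : set {poly {poly R[i]}} :=
  [set p : {poly {poly R[i]}} | forall i j : nat,
    \sum_(k < size p) \sum_(l < size p`_k)
      p`_k`_l * gamma (i + l)%N (j + k)%N = 0].

Definition is_rdis (s : nat) (init : nat -> nat -> R[i])
    (P : {poly {poly R[i]}}) (gamma : nat -> nat -> R[i]) : Prop :=
  exists a : nat -> nat -> R[i],
    [/\ P = 'X^s - \sum_(l < s) \sum_(k < s | (l + k < s)%N)
                     (a l k)%:P%:P * 'Y ^+ l * 'X ^+ k,
        forall i j : nat, (i <= j)%N -> (j < s)%N -> gamma i j = init i j,
        forall i j : nat, gamma j i = (gamma i j)^* &
        forall i j : nat, gamma i (j + s)%N =
          \sum_(l < s) \sum_(k < s | (l + k < s)%N)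
            a l k * gamma (i + l)%N (j + k)%N].

End ComplexMoments.

Arguments moment_col {R} d gamma i j ijd.

(* Main.v *)
(* On the zero set of P = z^3 + a z + b zb, either x = Re z = 0 or |z|^2 = b, so
   h = 0 there; a representing measure of omega satisfies int |P|^2 = 0, hence
   is carried by that set and kills the multiples of h.  Modulo P and its
   conjugate, z^2 h = z zb h = zb^2 h = - (a + b) h, so that the functional of
   gamma kills the whole ideal of h as soon as it kills h and z h.  In that case
   it factors through the quotient by (P, Pb, h), which has dimension 7, and
   P has exactly 7 zeros because b < a < 2b: 0, +-i s and +-p +- i q, with
   s^2 = a - b, p^2 = (2b - a) / 4 and q^2 = (2b + a) / 4.  Hence gamma is a
   combination of evaluations at these points.  Any six of them lie on three
   lines missing the seventh, so testing M(omega)(3) >= 0 on the product of the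
   three linear forms shows that the weights are nonnegative. *)

Require Import Defs.
From HB Require Import structures.
From mathcomp Require Import all_boot all_order all_algebra.
From mathcomp Require Import complex polyXY.
From mathcomp Require Import all_classical all_reals all_analysis.
From mathcomp Require Import measurable_realfun ring lra zify.

Set Implicit Arguments.
Unset Strict Implicit.
Unset Printing Implicit Defensive.

Import Order.TTheory GRing.Theory Num.Theory.
Import numFieldNormedType.Exports.

Local Open Scope classical_set_scope.
Local Open Scope complex_scope.
Local Open Scope ring_scope.

(** * Recursive sequences *)

Section Recursion.
Variables (R : realType) (a b : R).
Implicit Types gamma delta : nat -> nat -> R[i].

Definition conj_symmetric gamma := forall i j, gamma j i = (gamma i j)^*.

(** The functional with moments [gamma] kills every [zb^i z^j P], where [P = z^3 + a z + b zb]. *)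
Definition cubic_rec gamma := forall i j,
  gamma i j.+3 = - (a%:C * gamma i j.+1) - b%:C * gamma i.+1 j.

(** The value at [zb^i z^j h] of the functional with moments [gamma]. *)
Definition hrow gamma i j : R[i] :=
  gamma i.+1 j.+2 + gamma i.+2 j.+1 - b%:C * gamma i j.+1 - b%:C * gamma i.+1 j.

Lemma conj_real (x : R) : (x%:C)^* = x%:C.
Proof. by apply/eqP; rewrite eq_complex /= oppr0 !eqxx. Qed.

Lemma cubic_rec_conj gamma : conj_symmetric gamma -> cubic_rec gamma ->
  forall i j, gamma i.+3 j = - (a%:C * gamma i.+1 j) - b%:C * gamma i j.+1.
Proof.
move=> herm rec i j; rewrite (herm j) rec rmorphB rmorphN !rmorphM /=.
by rewrite !conj_real -!herm.
Qed.

Lemma hrow_conj gamma i j : conj_symmetric gamma -> hrow gamma j i = (hrow gamma i j)^*.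
Proof.
move=> herm; rewrite /hrow !rmorphB rmorphD !rmorphM /= !conj_real -!herm.
by ring.
Qed.

Lemma hrowS2 gamma : conj_symmetric gamma -> cubic_rec gamma ->
  forall i j, hrow gamma i j.+2 = - (a%:C + b%:C) * hrow gamma i j.
Proof.
move=> herm rec i j; have recc := cubic_rec_conj herm rec.
(* In [z^2 h], the terms in [z^4 zb], [z^3 zb^2] and [z^3] are reduced by [P]; this creates [zb^3],
   which the conjugate relation reduces. *)
rewrite /hrow (rec i.+1 j.+1) (rec i.+2 j) (recc i j) (rec i j).
by ring.
Qed.

Lemma hrowSS gamma : conj_symmetric gamma -> cubic_rec gamma ->
  forall i j, hrow gamma i.+1 j.+1 = - (a%:C + b%:C) * hrow gamma i j.
Proof.
move=> herm rec i j; have recc := cubic_rec_conj herm rec.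
rewrite /hrow (rec i.+2 j) (recc i j.+2) (rec i j) (recc i j).
by ring.
Qed.

(** Row 0 follows from its first two entries in steps of 2, column 0 from row 0 by conjugation, and
    the rest along the diagonals by [hrowSS]. *)
Lemma hrow_eq0 gamma : conj_symmetric gamma -> cubic_rec gamma ->
  hrow gamma 0 0 = 0 -> hrow gamma 0 1 = 0 -> forall i j, hrow gamma i j = 0.
Proof.
move=> herm rec h00 h01 i j.
have h0 : forall j, hrow gamma 0 j = 0.
  move=> n; suff [] : hrow gamma 0 n = 0 /\ hrow gamma 0 n.+1 = 0 by [].
  elim: n => [//|n [IH1 IH2]]; split=> //.
  by rewrite hrowS2 // IH1 mulr0.
elim: i j => [//|i IH] [|j]; first by rewrite hrow_conj // h0 rmorph0.
by rewrite hrowSS // IH mulr0.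
Qed.

(** Modulo [P], its conjugate and [h], every monomial reduces to 1, [z], [z^2], [zb z], [zb z^2] and
    their conjugates. *)
Lemma eq_sequence gamma delta :
  conj_symmetric gamma -> cubic_rec gamma -> (forall i j, hrow gamma i j = 0) ->
  conj_symmetric delta -> cubic_rec delta -> (forall i j, hrow delta i j = 0) ->
  gamma 0 0 = delta 0 0 -> gamma 0 1 = delta 0 1 -> gamma 0 2 = delta 0 2 ->
  gamma 1 1 = delta 1 1 -> gamma 1 2 = delta 1 2 ->
  forall i j, gamma i j = delta i j.
Proof.
move=> hg rg zg hd rd zd e00 e01 e02 e11 e12.
have e10 : gamma 1 0 = delta 1 0 by rewrite hg hd e01.
have e20 : gamma 2 0 = delta 2 0 by rewrite hg hd e02.
(* Up to conjugation, [zb^2 z^2] is the only monomial with exponents below 3 whose value is not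
   given. The relation for [z h] yields it, once [zb z^3] is reduced by [P]. *)
have e22 : gamma 2 2 = delta 2 2.
  move: (zg 0 1) (zd 0 1); rewrite /hrow rg rd e02 e11 e20 => zg01 zd01.
  apply: (addrI (- (a%:C * delta 1 1) - b%:C * delta 2 0)).
  apply/eqP; rewrite -subr_eq0 -(subrr 0) -{1}zg01 -zd01; apply/eqP.
  by ring.
(* By conjugation [i <= j] suffices: then [j < 3] leaves only the values above, and otherwise the
   recursion lowers the total degree by 2. *)
suff H n i j : (i <= j)%N -> (i + j <= n)%N -> gamma i j = delta i j.
  move=> i j; case: (leqP i j) => [ij|/ltnW ji]; first exact: (H (i + j)%N).
  by rewrite hg hd (H (j + i)%N).
elim: n i j => [|n IH] i j.
  by move=> _; rewrite leqn0 addn_eq0 => /andP[/eqP-> /eqP->].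
case: j => [|[|[|j]]]; case: i => [|[|[|i]]] //= ij ijn.
all: rewrite rg rd.
all: have IH' k l : (k + l <= n)%N -> gamma k l = delta k l
  by (case: (leqP k l) => [|/ltnW] kl kln;
    [apply: IH|rewrite hg hd IH // addnC]).
all: rewrite !IH' //; lia.
Qed.

End Recursion.

Lemma sum_real_complex (R : rcfType) n (w : nat -> R) (z : nat -> R[i]) :
  \sum_(k < n) (w k)%:C * z k =
  (\sum_(k < n) w k * complex.Re (z k)) +i* (\sum_(k < n) w k * complex.Im (z k)).
Proof.
elim/big_ind3: _ => //; first by move=> ? ? ? ? ? ? -> ->.
move=> k _; case: (z k) => u v; apply/eqP.
by rewrite eq_complex /= !mul0r subr0 addr0 !eqxx.
Qed.

(** * Moment matrices *)

Section MomentMatrix.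
Variable R : realType.
Implicit Types (gamma : nat -> nat -> R[i]).

Lemma mindex_at_rank d i j (ijd : (i + j <= d)%N) :
  mindex_at (enum_rank (mindex_of ijd)) = (inord i, inord j).
Proof. by rewrite /mindex_at enum_rankK. Qed.

(** The row index enters crosswise because the row monomial is conjugated. *)
Lemma moment_colE d gamma i j (ijd : (i + j <= d)%N) r :
  moment_col d gamma i j ijd r 0 =
  gamma (i + (mindex_at r).2)%N (j + (mindex_at r).1)%N.
Proof.
have id : (i <= d)%N := leq_trans (leq_addr j i) ijd.
have jd : (j <= d)%N := leq_trans (leq_addl i j) ijd.
rewrite !mxE mindex_at_rank; case: (mindex_at r) => k l /=.
by rewrite !inordK.
Qed.

Lemma mindex_ind d (P : nat -> nat -> Prop) :
  (forall r : 'I_#|{: mindex d}|, P (mindex_at r).1 (mindex_at r).2) <->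
  (forall k l, (k + l <= d)%N -> P k l).
Proof.
split=> [H k l kld|H r]; last by apply: H; exact: valP (enum_val r).
have := H (enum_rank (mindex_of kld)); rewrite mindex_at_rank /= !inordK //.
  exact: leq_trans (leq_addl k l) kld.
exact: leq_trans (leq_addr l k) kld.
Qed.

Lemma sum_mindex d (V : nmodType) (F : nat -> nat -> V) :
  \sum_(r < #|{: mindex d}|) F (mindex_at r).1 (mindex_at r).2 =
  \sum_(i < d.+1) \sum_(j < d.+1 | (i + j <= d)%N) F i j.
Proof.
rewrite pair_big_dep /=.
rewrite -(big_enum_val (A := {: mindex d}) (fun x => F (val x).1 (val x).2)) /=.
by rewrite -(big_sub _ (fun x : 'I_d.+1 * 'I_d.+1 => F x.1 x.2)).
Qed.

Definition eval_poly2 d (c : nat -> nat -> R[i]) (z : R[i]) : R[i] :=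
  \sum_(i < d.+1) \sum_(j < d.+1 | (i + j <= d)%N) c i j * (z^* ^+ i * z ^+ j).

(** At the coefficient vector of a polynomial, the quadratic form is the sum of its squared moduli
    at the points [x k], with real weights [w k] of either sign. *)
Lemma psd_atomic_moment d n (w : nat -> R) (x : nat -> R[i]) gamma c :
  psdmx (moment_mx d gamma) ->
  (forall i j, (i + j <= d + d)%N ->
     gamma i j = \sum_(k < n) (w k)%:C * ((x k)^* ^+ i * x k ^+ j)) ->
  0 <= \sum_(k < n) (w k)%:C * (eval_poly2 d c (x k) * (eval_poly2 d c (x k))^* ).
Proof.
move=> psd gE; have := psd (\col_r c (mindex_at r).1 (mindex_at r).2).
congr (0 <= _); rewrite -mulmxA mxE.
pose m k (r : 'I_#|{: mindex d}|) : R[i] :=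
  c (mindex_at r).1 (mindex_at r).2 *
  ((x k)^* ^+ (mindex_at r).1 * x k ^+ (mindex_at r).2).
have evE k : eval_poly2 d c (x k) = \sum_r m k r 
  by rewrite /m (sum_mindex d (fun i j => c i j * ((x k)^* ^+ i * x k ^+ j))).
have sqE k : (w k)%:C * (eval_poly2 d c (x k) * (eval_poly2 d c (x k))^* ) =
    \sum_r \sum_s (w k)%:C * (m k s * (m k r)^* ) :> R[i].
  rewrite exchange_big evE mulr_suml mulr_sumr; apply: eq_bigr => s _.
  rewrite -mulr_sumr; congr (_ * _); rewrite -mulr_sumr; congr (_ * _).
  exact: (rmorph_sum Num.conj).
under [RHS]eq_bigr do rewrite sqE.
under [LHS]eq_bigr => r _.
  rewrite !mxE mulr_sumr.
  under eq_bigr => s _.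
    rewrite !mxE.
    over.
  over.
rewrite [RHS]exchange_big /=; apply: eq_bigr => r _.
rewrite [RHS]exchange_big /=; apply: eq_bigr => s _.
have rd : ((mindex_at r).1 + (mindex_at r).2 <= d)%N := valP (enum_val r).
have sd : ((mindex_at s).1 + (mindex_at s).2 <= d)%N := valP (enum_val s).
rewrite /m; move: rd sd; case: (mindex_at r) (mindex_at s) => k l [i j] /= kl ij.
rewrite gE; last by lia.
rewrite mulr_suml mulr_sumr; apply: eq_bigr => q _.
by rewrite !rmorphM /= !rmorphXn /= conjCK !exprD; ring.
Qed.

Lemma eval_poly2_deg3 c z : eval_poly2 3 c z =
  c 0 0 + c 0 1 * z + c 0 2 * z ^+ 2 + c 0 3 * z ^+ 3
  + c 1 0 * z^* + c 1 1 * (z^* * z) + c 1 2 * (z^* * z ^+ 2)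
  + c 2 0 * z^* ^+ 2 + c 2 1 * (z^* ^+ 2 * z) + c 3 0 * z^* ^+ 3.
Proof.
rewrite /eval_poly2; under eq_bigr do rewrite big_mkcond.
rewrite !big_ord_recl !big_ord0 /bump /=.
by move: z^* => zb; ring.
Qed.

(** A product of three affine forms in [z] and [zb] has degree at most 3, so it is among the
    polynomials tested by [moment_mx 3]; [c] lists its ten coefficients. *)
Lemma psd_lines n (w : nat -> R) (x : nat -> R[i]) gamma (A B C : nat -> R[i]) :
  psdmx (moment_mx 3 gamma) ->
  (forall i j, (i + j <= 6)%N ->
     gamma i j = \sum_(k < n) (w k)%:C * ((x k)^* ^+ i * x k ^+ j)) ->
  0 <= \sum_(k < n) (w k)%:C *
    (\prod_(t < 3) (A t * x k + B t * (x k)^* + C t) *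
     (\prod_(t < 3) (A t * x k + B t * (x k)^* + C t))^* ).
Proof.
move=> psd gE.
pose c i j := match i, j with
  | 0, 0 => C 0 * C 1 * C 2
  | 0, 1 => A 0 * C 1 * C 2 + C 0 * A 1 * C 2 + C 0 * C 1 * A 2
  | 1, 0 => B 0 * C 1 * C 2 + C 0 * B 1 * C 2 + C 0 * C 1 * B 2
  | 0, 2 => A 0 * A 1 * C 2 + A 0 * C 1 * A 2 + C 0 * A 1 * A 2
  | 2, 0 => B 0 * B 1 * C 2 + B 0 * C 1 * B 2 + C 0 * B 1 * B 2
  | 1, 1 => A 0 * B 1 * C 2 + A 0 * C 1 * B 2 + C 0 * A 1 * B 2
            + B 0 * A 1 * C 2 + B 0 * C 1 * A 2 + C 0 * B 1 * A 2
  | 0, 3 => A 0 * A 1 * A 2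
  | 1, 2 => B 0 * A 1 * A 2 + A 0 * B 1 * A 2 + A 0 * A 1 * B 2
  | 2, 1 => A 0 * B 1 * B 2 + B 0 * A 1 * B 2 + B 0 * B 1 * A 2
  | 3, 0 => B 0 * B 1 * B 2
  | _, _ => 0
  end.
have cE z : \prod_(t < 3) (A t * z + B t * z^* + C t) = eval_poly2 3 c z.
  rewrite eval_poly2_deg3 /c !big_ord_recl big_ord0 /bump /=.
  by move: z^* => zb; ring.
under eq_bigr do rewrite cE; exact: psd_atomic_moment psd gE.
Qed.

End MomentMatrix.

(** * Integrals of complex-valued functions *)

Section AtomicMeasure.
Context d (T : measurableType d) (R : realType).
Variables (n : nat) (w : nat -> {nonneg R}) (x : nat -> T).

Definition atomic_measure : {measure set T -> \bar R} :=
  msum (fun k => mscale (w k) (\d_(x k) : {measure set T -> \bar R})) n.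

Lemma ge0_integral_atomic (f : T -> R) : measurable_fun setT f ->
  (forall t, 0 <= f t) ->
  (\int[atomic_measure]_t (f t)%:E = (\sum_(k < n) (w k)%:num * f (x k))%:E)%E.
Proof.
move=> mf f0.
have /measurable_EFinP mEf := mf.
rewrite ge0_integral_measure_sum //; last by move=> t _; rewrite lee_fin.
rewrite -sumEFin; apply: eq_bigr => k _.
rewrite ge0_integral_mscale //; last by move=> t _; rewrite lee_fin.
by rewrite integral_dirac //= diracT mul1e EFinM.
Qed.

Lemma ge0_integrable_atomic (f : T -> R) : measurable_fun setT f ->
  (forall t, 0 <= f t) -> atomic_measure.-integrable setT (EFin \o f).
Proof.
move=> mf f0; apply/integrableP; split; first exact/measurable_EFinP.
under eq_integral do rewrite /= ger0_norm //.
by rewrite ge0_integral_atomic // ltry.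
Qed.

Lemma integral_atomic (f : T -> R) : measurable_fun setT f ->
  atomic_measure.-integrable setT (EFin \o f) /\
  \int[atomic_measure]_t f t = \sum_(k < n) (w k)%:num * f (x k).
Proof.
move=> mf.
pose fp t := Num.max (f t) 0; pose fn t := Num.max (- f t) 0.
have fE t : f t = fp t - fn t by rewrite /fp /fn; case: leP => ?; case: leP => ?; lra.
have mfp : measurable_fun setT fp by exact: measurable_maxr.
have mfn : measurable_fun setT fn.
  by apply: measurable_maxr => //; exact: measurableT_comp.
have fp0 t : 0 <= fp t by rewrite /fp le_max lexx orbT.
have fn0 t : 0 <= fn t by rewrite /fn le_max lexx orbT.
have ip := ge0_integrable_atomic mfp fp0.
have im := ge0_integrable_atomic mfn fn0.
rewrite (_ : f = fun t => fp t - fn t); last exact/funext.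
split; first exact: (integrableB measurableT ip im).
rewrite RintegralB // /Rintegral !ge0_integral_atomic //= -sumrB.
by apply: eq_bigr => k _; rewrite mulrBr.
Qed.

End AtomicMeasure.

Section ComplexIntegral.
Variable R : realType.
Implicit Types (mu : {measure set (borelC R) -> \bar R}) (f g : borelC R -> R[i]).

Definition has_cintegral mu f (v : R[i]) := cintegrable mu f /\ v = cintegral mu f.

Lemma has_cintegralD mu f g u v : has_cintegral mu f u -> has_cintegral mu g v ->
  has_cintegral mu (fun z => f z + g z) (u + v).
Proof.
move=> [[fr fi] ->] [[gr gi] ->].
have eRe : (fun z => complex.Re (f z + g z)) =
  fun z => complex.Re (f z) + complex.Re (g z).
  by apply/funext => z; case: (f z) (g z) => [? ?] [].
have eIm : (fun z => complex.Im (f z + g z)) =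
  fun z => complex.Im (f z) + complex.Im (g z).
  by apply/funext => z; case: (f z) (g z) => [? ?] [].
split; first split.
- rewrite (_ : (fun z => _) = EFin \o (fun z => complex.Re (f z + g z))) // eRe.
  exact: (integrableD measurableT fr gr).
- rewrite (_ : (fun z => _) = EFin \o (fun z => complex.Im (f z + g z))) // eIm.
  exact: (integrableD measurableT fi gi).
by rewrite /cintegral eRe eIm !RintegralD.
Qed.

Lemma has_cintegralZ mu (c : R) f v : has_cintegral mu f v ->
  has_cintegral mu (fun z => c%:C * f z) (c%:C * v).
Proof.
move=> [[fr fi] ->].
have eRe : (fun z => complex.Re (c%:C * f z)) = fun z => c * complex.Re (f z).
  by apply/funext => z; case: (f z) => u v' /=; rewrite mul0r subr0.
have eIm : (fun z => complex.Im (c%:C * f z)) = fun z => c * complex.Im (f z).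
  by apply/funext => z; case: (f z) => u v' /=; rewrite mul0r addr0.
split; first split.
- rewrite (_ : (fun z => _) = EFin \o (fun z => complex.Re (c%:C * f z))) // eRe.
  exact: (integrableZl measurableT c fr).
- rewrite (_ : (fun z => _) = EFin \o (fun z => complex.Im (c%:C * f z))) // eIm.
  exact: (integrableZl measurableT c fi).
rewrite /cintegral eRe eIm !RintegralZl //.
by apply/eqP; rewrite eq_complex /= !mul0r subr0 addr0 !eqxx.
Qed.

Definition cmeasurable f := measurable_fun setT (fun z => complex.Re (f z)) /\
  measurable_fun setT (fun z => complex.Im (f z)).

Lemma cmeasurable_integrable mu f : cintegrable mu f -> cmeasurable f.
Proof.
by move=> [/measurable_int/measurable_EFinP ? /measurable_int/measurable_EFinP ?].
Qed.

Lemma cmeasurableM f g : cmeasurable f -> cmeasurable g ->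
  cmeasurable (fun z => f z * g z).
Proof.
move=> [fr fi] [gr gi]; split.
- rewrite (_ : (fun z => _) = fun z => complex.Re (f z) * complex.Re (g z) -
    complex.Im (f z) * complex.Im (g z)).
    by apply: measurable_funB; apply: measurable_funM.
  by apply/funext => z; case: (f z) (g z) => [? ?] [].
- rewrite (_ : (fun z => _) = fun z => complex.Re (f z) * complex.Im (g z) +
    complex.Im (f z) * complex.Re (g z)).
    by apply: measurable_funD; apply: measurable_funM.
  by apply/funext => z; case: (f z) (g z) => [? ?] [].
Qed.

(** Such a function is continuous, so the preimages of open intervals, which generate the Borel sets
    of the line, are open. The norm of [R[i]] has values in [R[i]], whence the embedding on the
    left. *)
Lemma lipschitz_measurable (g : R[i] -> R) :
  (forall z t, (`|g z - g t|%:C <= `|z - t|)) ->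
  measurable_fun setT (g : borelC R -> R).
Proof.
move=> lip; apply: (measurability _ (RGenOpens.measurableE R)).
move=> _ [_ [x [y ->]] <-]; rewrite setTI; apply: sub_sigma_algebra.
rewrite /mkset openE => z zA /=.
have /open_nbhs_nbhs/nbhs_ballP [e /= e0 eA] : open_nbhs (g z) `]x, y[%classic.
  by split => //; exact: interval_open.
apply/nbhs_ballP; exists e%:C => /=; first by rewrite ltcR.
move=> t zt; apply: eA; rewrite /ball /= -ltcR.
exact: le_lt_trans (lip _ _) zt.
Qed.

Lemma cmeasurable_id : cmeasurable (id : borelC R -> R[i]).
Proof.
have H (u v : R) : `|u| <= Num.sqrt (u ^+ 2 + v ^+ 2).
  by rewrite -sqrtr_sqr ler_wsqrtr // lerDl sqr_ge0.
have H' (u v : R) : `|v| <= Num.sqrt (u ^+ 2 + v ^+ 2) by rewrite addrC H.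
by split; apply: lipschitz_measurable => -[u v] [u' v'];
  rewrite lecR; [exact: H|exact: H'].
Qed.

Lemma cmeasurable_conj : cmeasurable (fun z : borelC R => (z : R[i])^*).
Proof.
have [mr mi] := cmeasurable_id; split.
- rewrite (_ : (fun z => _) = fun z : borelC R => complex.Re z) //.
  by apply/funext => -[].
- rewrite (_ : (fun z => _) = fun z : borelC R => - complex.Im z).
    exact: measurableT_comp.
  by apply/funext => -[].
Qed.

Lemma cmeasurableX f n : cmeasurable f -> cmeasurable (fun z => f z ^+ n).
Proof.
move=> mf; elim: n => [|n IH]; first by split; exact: measurable_cst.
rewrite (_ : (fun z => _) = fun z => f z * f z ^+ n); first exact: cmeasurableM.
by apply/funext => z; rewrite exprS.
Qed.

Lemma cmeasurable_monomial i j : cmeasurable (@monomial R i j).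
Proof.
by apply: cmeasurableM; apply: cmeasurableX;
  [exact: cmeasurable_conj|exact: cmeasurable_id].
Qed.

Lemma has_cintegral_atomic n (w : nat -> {nonneg R}) (x : nat -> borelC R) f :
  cmeasurable f ->
  has_cintegral (atomic_measure n w x) f (\sum_(k < n) ((w k)%:num)%:C * f (x k)).
Proof.
move=> [mr mi]; have [ir er] := integral_atomic n w x mr.
have [ii ei] := integral_atomic n w x mi.
split=> //; rewrite /cintegral er ei.
exact: (sum_real_complex n (fun k => (w k)%:num) (fun k => f (x k))).
Qed.

(** The integrand is the nonnegative function [|f|^2]; as its integral is zero it vanishes almost
    everywhere, and [f] with it. *)
Lemma has_cintegral_normsq0 mu f : cmeasurable f ->
  has_cintegral mu (fun z => f z * (f z)^* ) 0 ->
  \forall z \ae mu, f z = 0.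
Proof.
move=> [mr mi] [[ir _] [i0 _]].
have n0 z : 0 <= complex.Re (f z * (f z)^* ).
  by case: (f z) => u v /=; rewrite mulrN opprK addr_ge0 // -expr2 sqr_ge0.
have [] := ae_eq_integral_abs mu measurableT (measurable_int _ ir).
move=> + _; case.
  under eq_integral do rewrite /= ger0_norm //.
  by rewrite -(fineK (integrable_fin_num measurableT ir)) -[fine _]i0.
move=> N [mN N0 sub]; exists N; split => // z /= fz; apply: sub => /= H; apply: fz.
have := H I; case: (f z) => u v /= [] /eqP.
rewrite mulrN opprK -!expr2 paddr_eq0 ?sqr_ge0 // !sqrf_eq0 => /andP[/eqP-> /eqP->].
by [].
Qed.

Lemma has_cintegral_ae0 mu f v : (\forall z \ae mu, f z = 0) ->
  has_cintegral mu f v -> v = 0.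
Proof.
move=> f0 [fi ->]; have [mr mi] := cmeasurable_integrable fi.
suff H (g : R[i] -> R) : g 0 = 0 -> measurable_fun setT (g \o f) ->
    \int[mu]_z g (f z) = 0.
  by rewrite /cintegral (H (@complex.Re R)) // (H (@complex.Im R)).
move=> g0 mg; rewrite /Rintegral (@ae_eq_integral _ _ _ mu setT (cst 0%E)) //.
- by rewrite integral0.
- exact/measurable_EFinP.
- by apply: filterS f0 => z /= -> _; rewrite g0.
Qed.

End ComplexIntegral.

(** * The seven atoms *)

Section SevenAtoms.
Variables (R : realType) (p q s : R).
Hypotheses (p0 : 0 < p) (q0 : 0 < q) (s0 : 0 < s).
Hypothesis pqs : q ^+ 2 = s ^+ 2 + 3 * p ^+ 2.

(** These solve [s^2 = a - b] and [4 p^2 = 2 b - a], so that the identities at the atoms become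
    polynomial in [p], [q], [s]. *)
Let a : R := 2 * s ^+ 2 + 4 * p ^+ 2.
Let b : R := s ^+ 2 + 4 * p ^+ 2.

(** The default value 0 puts [node k] at the origin for [k >= 7], again a common zero of [P] and
    [h], so the identities below hold for every [k]. *)
Definition node_re (k : nat) : R := [:: 0; 0; 0; p; p; - p; - p]`_k.
Definition node_im (k : nat) : R := [:: 0; s; - s; q; - q; q; - q]`_k.
Definition node (k : nat) : R[i] := node_re k +i* node_im k.

Lemma node_cubic k : node k ^+ 3 = - (a%:C * node k) - b%:C * (node k)^*.
Proof.
have pqs' : q * q = s * s + 3 * (p * p) by rewrite -!expr2 pqs.
(* The real part of [P] at [x + i y] is divisible by [x], the imaginary part by [y]. *)
have E (x y : R) : x * (x * x - y * y - y * y * 2 + a + b) = 0 ->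
    y * (x * x * 3 - y * y + (a - b)) = 0 ->
    (x +i* y : R[i]) ^+ 3 = - (a%:C * (x +i* y)) - b%:C * (x +i* y)^*.
  move=> ex ey; rewrite [(x +i* y) ^+ 3]exprS expr2.
  apply/eqP; rewrite eq_complex /=; apply/andP; split; apply/eqP.
  - by apply/eqP; rewrite -subr_eq0 -[X in _ == X]ex; apply/eqP; ring.
  - by apply/eqP; rewrite -subr_eq0 -[X in _ == X]ey; apply/eqP; ring.
apply: E; move: k => [|[|[|[|[|[|[|k]]]]]]];
  rewrite /node_re /node_im /= ?nth_nil /a /b ?mulrNN ?pqs'; ring.
Qed.

Lemma node_h k : (node k + (node k)^* ) * (node k * (node k)^* - b%:C) = 0.
Proof.
have pqs' : q * q = s * s + 3 * (p * p) by rewrite -!expr2 pqs.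
(* At [x + i y] the value of [h] is [2 x (x^2 + y^2 - b)]. *)
have E (x y : R) : x * (x * x + y * y - b) = 0 ->
    ((x +i* y : R[i]) + (x +i* y)^* ) * ((x +i* y) * (x +i* y)^* - b%:C) = 0.
  move=> ex; apply/eqP; rewrite eq_complex /=; apply/andP; split; apply/eqP.
  - by rewrite -[RHS](mulr0 2) -[X in _ = _ * X]ex; ring.
  - by ring.
apply: E; move: k => [|[|[|[|[|[|[|k]]]]]]];
  rewrite /node_re /node_im /= ?nth_nil /b ?mulrNN ?pqs'; ring.
Qed.

Definition atomic_moment (w : nat -> R) i j : R[i] :=
  \sum_(k < 7) (w k)%:C * ((node k)^* ^+ i * node k ^+ j).

Lemma atomic_moment_conj_sym w : conj_symmetric (atomic_moment w).
Proof.
move=> i j; rewrite [RHS](rmorph_sum Num.conj); apply: eq_bigr => k _.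
by rewrite !rmorphM /= !rmorphXn /= conjCK conj_real; congr (_ * _); rewrite mulrC.
Qed.

Lemma atomic_moment_cubic w : cubic_rec a b (atomic_moment w).
Proof.
move=> i j; rewrite !mulr_sumr -sumrN -sumrB; apply: eq_bigr => k _.
rewrite -[j.+3]addn3 exprD node_cubic !exprS; move: (node k)^* => zb.
by ring.
Qed.

Lemma atomic_moment_hrow w i j : hrow b (atomic_moment w) i j = 0.
Proof.
rewrite /hrow !mulr_sumr -big_split -!sumrB big1 //= => k _.
transitivity ((w k)%:C * ((node k)^* ^+ i * node k ^+ j) *
   ((node k + (node k)^* ) * (node k * (node k)^* - b%:C))).
  by rewrite !exprS; move: (node k)^* => zb; ring.
by rewrite node_h mulr0.
Qed.

Lemma psd_real_lines w gamma (al be ka : nat -> R) :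
  psdmx (moment_mx 3 gamma) ->
  (forall i j, (i + j <= 6)%N -> gamma i j = atomic_moment w i j) ->
  0 <= \sum_(k < 7) w k *
    (\prod_(t < 3) (al t * node_re k + be t * node_im k + ka t)) ^+ 2.
Proof.
move=> psd gE.
(* From [x = (z + zb) / 2] and [y = (z - zb) / (2 i)], the form [al x + be y + ka] has coefficient
   [(al - i be) / 2] at [z] and the conjugate one at [zb]. *)
have := psd_lines (fun t => (al t / 2) +i* (- (be t / 2)))
  (fun t => (al t / 2) +i* (be t / 2)) (fun t => (ka t)%:C) psd gE.
rewrite -ler0c [X in _ -> _ <= X](rmorph_sum (real_complex R)).
congr (0 <= _); apply: eq_bigr => k _.
pose v := \prod_(t < 3) (al t * node_re k + be t * node_im k + ka t).
suff uE : \prod_(t < 3) ((al t / 2) +i* (- (be t / 2)) * node k +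
    (al t / 2) +i* (be t / 2) * (node k)^* + (ka t)%:C) = v%:C.
  transitivity ((w k)%:C * (v%:C * (v%:C)^* )).
    by congr (_ * (_ * Num.conj _)); exact: uE.
  by rewrite conj_real -expr2 -rmorphXn -rmorphM.
rewrite rmorph_prod; apply: eq_bigr => t _.
apply/eqP; rewrite eq_complex /=; apply/andP; split; apply/eqP; by field.
Qed.

Lemma atomic_weight_ge0 w gamma : psdmx (moment_mx 3 gamma) ->
  (forall i j, (i + j <= 6)%N -> gamma i j = atomic_moment w i j) ->
  forall k, (k < 7)%N -> 0 <= w k.
Proof.
move=> psd gE k k7.
(* The product of the three forms vanishes at all atoms but one, where it equals [c] up to sign; the
   sum collapses to that term. *)
suff [c c0 [al [be [ka E]]]] : exists2 c : R, c != 0 &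
    exists al be ka : nat -> R, \sum_(k < 7) w k *
    (\prod_(t < 3) (al t * node_re k + be t * node_im k + ka t)) ^+ 2 =
    w k * c ^+ 2.
  have := psd_real_lines al be ka psd gE; rewrite E pmulr_lge0 //.
  by rewrite exprn_even_gt0.
have [p1 q1 s1] : [/\ p != 0, q != 0 & s != 0] by rewrite !gt_eqF.
have n2 : (2 : R) != 0 by rewrite pnatr_eq0.
move: k k7 => [|[|[|[|[|[|[|//]]]]]]] _.
(* For the origin: the line through [(0, s)] and [(p, q)], its mirror image in the real axis, and
   the side [x = -p] of the rectangle of corners. *)
- exists (s * p * (s * p) * p); first by rewrite !mulf_neq0.
  exists (nth 0 [:: q - s; q - s; 1]), (nth 0 [:: - p; p; 0]),
    (nth 0 [:: s * p; s * p; p]).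
  by rewrite !big_ord_recl !big_ord0 /node_re /node_im /bump /=; ring.
(* For [(0, s)], and likewise for [(0, -s)]: the two diagonals of the rectangle, which also meet the
   origin, and the horizontal line through the other axis atom. *)
- exists (p * s * (p * s) * (2 * s)); first by rewrite !mulf_neq0.
  exists (nth 0 [:: q; q; 0]), (nth 0 [:: - p; p; 1]), (nth 0 [:: 0; 0; s]).
  by rewrite !big_ord_recl !big_ord0 /node_re /node_im /bump /=; ring.
- exists (p * s * (p * s) * (2 * s)); first by rewrite !mulf_neq0.
  exists (nth 0 [:: q; q; 0]), (nth 0 [:: - p; p; 1]), (nth 0 [:: 0; 0; - s]).
  by rewrite !big_ord_recl !big_ord0 /node_re /node_im /bump /=; ring.
(* For each corner: the axis [x = 0] and the two sides of the rectangle that avoid this corner. *)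
- exists (p * (2 * p) * (2 * q)); first by rewrite !mulf_neq0.
  exists (nth 0 [:: 1; 1; 0]), (nth 0 [:: 0; 0; 1]), (nth 0 [:: 0; p; q]).
  by rewrite !big_ord_recl !big_ord0 /node_re /node_im /bump /=; ring.
- exists (p * (2 * p) * (2 * q)); first by rewrite !mulf_neq0.
  exists (nth 0 [:: 1; 1; 0]), (nth 0 [:: 0; 0; 1]), (nth 0 [:: 0; p; - q]).
  by rewrite !big_ord_recl !big_ord0 /node_re /node_im /bump /=; ring.
- exists (p * (2 * p) * (2 * q)); first by rewrite !mulf_neq0.
  exists (nth 0 [:: 1; 1; 0]), (nth 0 [:: 0; 0; 1]), (nth 0 [:: 0; - p; q]).
  by rewrite !big_ord_recl !big_ord0 /node_re /node_im /bump /=; ring.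
- exists (p * (2 * p) * (2 * q)); first by rewrite !mulf_neq0.
  exists (nth 0 [:: 1; 1; 0]), (nth 0 [:: 0; 0; 1]), (nth 0 [:: 0; - p; - q]).
  by rewrite !big_ord_recl !big_ord0 /node_re /node_im /bump /=; ring.
Qed.

(* The weights are the values of the functional on the Lagrange interpolants
   of the nodes in the span of 1, x, y, x^2, x y, y^2, x^2 y, where z = x + i y. *)
Lemma atomic_weights gamma : conj_symmetric gamma ->
  complex.Re (gamma 1 2) = b * complex.Re (gamma 0 1) ->
  exists w, [/\ gamma 0 0 = atomic_moment w 0 0, gamma 0 1 = atomic_moment w 0 1,
    gamma 0 2 = atomic_moment w 0 2, gamma 1 1 = atomic_moment w 1 1 &
    gamma 1 2 = atomic_moment w 1 2].
Proof.
move=> herm re12.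
have real k : complex.Im (gamma k k) = 0.
  have := herm k k; case: (gamma k k) => u v [] /eqP.
  by rewrite -subr_eq0 opprK -mulr2n mulrn_eq0 /= => /eqP.
pose m00 := complex.Re (gamma 0 0).
pose m10 := complex.Re (gamma 0 1); pose m01 := complex.Im (gamma 0 1).
pose m20 := (complex.Re (gamma 1 1) + complex.Re (gamma 0 2)) / 2.
pose m02 := (complex.Re (gamma 1 1) - complex.Re (gamma 0 2)) / 2.
pose m11 := complex.Im (gamma 0 2) / 2.
(* The moment of [x^2 y]. It comes from [Im (zb z^2) = x^2 y + y^3], which equals [4 x^2 y + s^2 y]
   at every atom: [y^3 = s^2 y] on the axis, and [p^2 + q^2 = s^2 + 4 p^2] at the corners. *)
pose m21 := (complex.Im (gamma 1 2) - s ^+ 2 * m01) / 4.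
(* The even and odd parts in [y] of the interpolant at [(0, s)]: multiples of
   [y^2 - (q^2 / p^2) x^2] and [y - x^2 y / p^2], both zero at the origin and the corners. *)
pose axis0 := (m02 - q ^+ 2 / p ^+ 2 * m20) / (2 * s ^+ 2).
pose axis1 := (m01 - m21 / p ^+ 2) / (2 * s).
(* The interpolant at the corner [(e p, d q)], for signs [e] and [d]. *)
pose corner e d := (q * m20 + e * (p * q) * m10 + d * m21 + e * d * p * m11) /
  (4 * p ^+ 2 * q).
pose w := nth 0 [:: m00 - m20 / p ^+ 2 - 2 * axis0; axis0 + axis1; axis0 - axis1;
  corner 1 1; corner 1 (-1); corner (-1) 1; corner (-1) (-1)].
have [p1 q1 s1] : [/\ p != 0, q != 0 & s != 0] by rewrite !gt_eqF.
have E i j (f g : R -> R -> R) :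
    (forall x y, (x +i* y)^* ^+ i * (x +i* y) ^+ j = (f x y) +i* (g x y)) ->
    complex.Re (gamma i j) = \sum_(k < 7) w k * f (node_re k) (node_im k) ->
    complex.Im (gamma i j) = \sum_(k < 7) w k * g (node_re k) (node_im k) ->
    gamma i j = atomic_moment w i j.
  move=> fgE reE imE.
  rewrite [RHS](sum_real_complex 7 w (fun k => (node k)^* ^+ i * node k ^+ j)).
  apply/eqP; rewrite eq_complex /= reE imE.
  by apply/andP; split; apply/eqP; apply: eq_bigr => k _; rewrite fgE.
have monoE (u v u' v' : R) : u = u' -> v = v' -> u +i* v = u' +i* v' by move=> -> ->.
have gE : complex.Im (gamma 1 2) = 4 * m21 + s ^+ 2 * m01 by rewrite /m21; field.
exists w; split.
- apply: (E _ _ (fun _ _ => 1) (fun _ _ => 0)).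
  + by move=> x y; rewrite !expr0 mulr1.
  + rewrite !big_ord_recl big_ord0 /bump /w /= /corner -/m00.
    by field; rewrite p1 q1.
  + by rewrite real big1 // => k _; rewrite mulr0.
- apply: (E _ _ (fun x _ => x) (fun _ y => y)).
  + by move=> x y; rewrite mul1r.
  + rewrite !big_ord_recl big_ord0 /bump /w /node_re /= /corner -/m10.
    by field; rewrite p1 q1.
  + rewrite !big_ord_recl big_ord0 /bump /w /node_im /= /corner /axis1 -/m01.
    by field; rewrite p1 q1.
- apply: (E _ _ (fun x y => x ^+ 2 - y ^+ 2) (fun x y => 2 * x * y)).
  + by move=> x y; rewrite expr0 mul1r expr2; apply: monoE; ring.
  + rewrite !big_ord_recl big_ord0 /bump /w /node_im /node_re /= /corner /axis0.
    rewrite (_ : complex.Re _ = m20 - m02); last by rewrite /m20 /m02; field.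
    by field; rewrite p1 q1 s1.
  + rewrite !big_ord_recl big_ord0 /bump /w /node_im /node_re /= /corner.
    rewrite (_ : complex.Im _ = 2 * m11); last by rewrite /m11; field.
    by field; rewrite p1 q1.
- apply: (E _ _ (fun x y => x ^+ 2 + y ^+ 2) (fun _ _ => 0)).
  + by move=> x y; rewrite !expr1; apply: monoE; ring.
  + rewrite !big_ord_recl big_ord0 /bump /w /node_im /node_re /= /corner /axis0.
    rewrite (_ : complex.Re _ = m20 + m02); last by rewrite /m20 /m02; field.
    by field; rewrite p1 q1 s1.
  + by rewrite real big1 // => k _; rewrite mulr0.
- apply: (E _ _ (fun x y => x ^+ 3 + x * y ^+ 2) (fun x y => x ^+ 2 * y + y ^+ 3)).
  + by move=> x y; rewrite expr1 expr2; apply: monoE; ring.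
  + rewrite re12 !big_ord_recl big_ord0 /bump /w /node_im /node_re /= /corner -/m10.
    (* At every atom [x^3 + x y^2 = (p^2 + q^2) x = b x], which is why the hypothesis on [gamma 1 2]
       is needed for an atomic form. *)
    transitivity ((q ^+ 2 + p ^+ 2) * m10); first by rewrite pqs /b; ring.
    by field; rewrite p1 q1.
  + rewrite gE !big_ord_recl big_ord0 /bump /w /node_im /node_re /= /corner /axis1.
    transitivity (s ^+ 2 * m01 + (q ^+ 2 + p ^+ 2 - s ^+ 2) / p ^+ 2 * m21).
      by rewrite pqs; field.
    by field; rewrite p1 q1 s1.
Qed.

End SevenAtoms.

(** * Characteristic polynomials *)

Section Polynomials.
Variable R : realType.
Implicit Types (omega gamma : nat -> nat -> R[i]) (p : {poly {poly R[i]}}).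

Lemma coef_monomialXY l k i j :
  ('Y ^+ l * 'X ^+ k : {poly {poly R[i]}})`_j`_i = ((i == l) && (j == k))%:R.
Proof.
rewrite -rmorphXn coefCM coefXn /=; case: (j == k); last by rewrite mulr0 coef0 andbF.
by rewrite mulr1 coefXn andbT.
Qed.

Lemma coef_monomialXY_eq0 l k i j : (l + k < i + j)%N ->
  ('Y ^+ l * 'X ^+ k : {poly {poly R[i]}})`_j`_i = 0.
Proof.
move=> lt; rewrite coef_monomialXY; case: eqP => //= il; case: eqP => //= jk.
by rewrite il jk ltnn in lt.
Qed.

Lemma coef_scaleXY (c : R[i]) p i j : (c%:P%:P * p)`_j`_i = c * p`_j`_i.
Proof. by rewrite !coefCM. Qed.

Lemma coef_linXY (c : R[i]) p1 p2 i j :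
  (p1 + c%:P%:P * p2)`_j`_i = p1`_j`_i + c * p2`_j`_i.
Proof. by rewrite coefD coefD coef_scaleXY. Qed.

Lemma Lambda_lin n omega c p1 p2 :
  Lambda n omega (p1 + c%:P%:P * p2) = Lambda n omega p1 + c * Lambda n omega p2.
Proof.
rewrite /Lambda mulr_sumr -big_split; apply: eq_bigr => i _.
rewrite mulr_sumr -big_split; apply: eq_bigr => j _.
by rewrite coef_linXY /=; ring.
Qed.

Lemma Lambda_monomial n omega l k : (l + k <= n)%N ->
  Lambda n omega ('Y ^+ l * 'X ^+ k) = omega l k.
Proof.
move=> lkn.
have ln : (l < n.+1)%N by rewrite ltnS (leq_trans _ lkn) ?leq_addr.
have kn : (k < n.+1)%N by rewrite ltnS (leq_trans _ lkn) ?leq_addl.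
rewrite /Lambda (bigD1 (Ordinal ln)) //= (bigD1 (Ordinal kn)) //=.
rewrite coef_monomialXY !eqxx mul1r !big1 ?addr0 //.
- move=> i; rewrite -val_eqE /= => /negPf ne; rewrite big1 // => j _.
  by rewrite coef_monomialXY ne mul0r.
- move=> j /andP[_]; rewrite -val_eqE /= => /negPf ne.
  by rewrite coef_monomialXY ne andbF mul0r.
Qed.

(** The sums on the left range over the sizes of [p] and its coefficients, [Lambda] over a fixed
    triangle; the degree bound makes the terms not in common zero. *)
Lemma charpoly_Lambda n gamma p : (forall k l, (n < l + k)%N -> p`_k`_l = 0) ->
  \sum_(k < size p) \sum_(l < size p`_k) p`_k`_l * gamma l k = Lambda n gamma p.
Proof.
move=> p0.
have sp : (size p <= n.+1)%N.
  apply/leq_sizeP => k nk; apply/polyP => l; rewrite coef0 p0 //.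
  by rewrite (leq_trans nk) ?leq_addl.
have spk k : (size (p`_k)%R <= n.+1)%N.
  by apply/leq_sizeP => l nl; rewrite p0 // (leq_trans nl) ?leq_addr.
rewrite /Lambda; under [RHS]eq_bigr do rewrite big_mkcond.
rewrite exchange_big /=.
rewrite (big_ord_widen _ (fun k => \sum_(l < size p`_k) p`_k`_l * gamma l k) sp).
rewrite big_mkcond; apply: eq_bigr => k _; case: ltnP => [_|pk]; last first.
  by rewrite big1 // => l _; rewrite (nth_default _ pk) coef0 mul0r if_same.
rewrite (big_ord_widen _ (fun l => p`_k`_l * gamma l k) (spk k)).
rewrite big_mkcond; apply: eq_bigr => l _; case: ltnP => [_|pl]; last first.
  by rewrite (nth_default _ pl) mul0r if_same.
by case: leqP => // /p0 ->; rewrite mul0r.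
Qed.

(** [is_rdis] only provides some coefficients [c] that express [P]. Comparing both sides forces
    [c 0 1 = -a], [c 1 0 = -b] and the other four to vanish. *)
Lemma is_rdis_cubic (a b : R) omega gamma :
  is_rdis 3 omega ('X^3 + a%:C%:P%:P * 'X + b%:C%:P%:P * 'Y) gamma ->
  [/\ conj_symmetric gamma, cubic_rec a b gamma &
    forall i j, (i <= j)%N -> (j < 3)%N -> gamma i j = omega i j].
Proof.
move=> [c [PE init herm rec]]; split => // i j.
have ceq l k : a%:C * ((l == 0%N) && (k == 1%N))%:R +
    b%:C * ((l == 1%N) && (k == 0%N))%:R =
    - \sum_(l' < 3) \sum_(k' < 3 | (l' + k' < 3)%N)
      c l' k' * ((l == l') && (k == k'))%:R.
  have := congr1 (fun p : {poly {poly R[i]}} => p`_k`_l) PE.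
  rewrite 2!coefB 4!coefD 2!coef_scaleXY -addrA => /addrI.
  have Xc : ('X : {poly {poly R[i]}})`_k`_l = ((l == 0%N) && (k == 1%N))%:R.
    rewrite coefX andbC; case: (k == 1%N); last exact: coef0.
    exact: coef1.
  have Yc : ('Y : {poly {poly R[i]}})`_k`_l = ((l == 1%N) && (k == 0%N))%:R.
    rewrite coefC andbC; case: (k == 0%N); last exact: coef0.
    exact: coefX.
  rewrite Xc Yc => ->; congr (- _).
  rewrite !coef_sum; apply: eq_bigr => l' _; rewrite !coef_sum.
  by apply: eq_bigr => k' _; rewrite -mulrA coef_scaleXY coef_monomialXY.
have exp l k : a%:C * ((l == 0%N) && (k == 1%N))%:R +
    b%:C * ((l == 1%N) && (k == 0%N))%:R =
    - (c 0 0 * ((l == 0%N) && (k == 0%N))%:R + c 0 1 * ((l == 0%N) && (k == 1%N))%:R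
     + c 0 2 * ((l == 0%N) && (k == 2%N))%:R + c 1 0 * ((l == 1%N) && (k == 0%N))%:R
     + c 1 1 * ((l == 1%N) && (k == 1%N))%:R + c 2 0 * ((l == 2%N) && (k == 0%N))%:R).
  rewrite ceq; congr (- _); under eq_bigr do rewrite big_mkcond.
  by rewrite !big_ord_recl !big_ord0 /bump /=; ring.
have simp := (mulr0, mulr1, addr0, add0r).
have c00 : c 0 0 = 0 by have /= /esym/eqP := exp 0 0; rewrite !simp oppr_eq0 => /eqP.
have c02 : c 0 2 = 0 by have /= /esym/eqP := exp 0 2; rewrite !simp oppr_eq0 => /eqP.
have c11 : c 1 1 = 0 by have /= /esym/eqP := exp 1 1; rewrite !simp oppr_eq0 => /eqP.
have c20 : c 2 0 = 0 by have /= /esym/eqP := exp 2 0; rewrite !simp oppr_eq0 => /eqP.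
have c01 : c 0 1 = - a%:C by have /= := exp 0 1; rewrite !simp => ->; rewrite opprK.
have c10 : c 1 0 = - b%:C by have /= := exp 1 0; rewrite !simp => ->; rewrite opprK.
rewrite -addn3 rec; under eq_bigr do rewrite big_mkcond.
rewrite !big_ord_recl !big_ord0 /bump /= c00 c01 c02 c10 c11 c20.
by rewrite !addn0 !addn1; ring.
Qed.

Definition hpoly (b : R) : {poly {poly R[i]}} := ('X + 'Y) * ('X * 'Y - b%:C%:P%:P).

(** The redundant exponents 0 and 1 and the factor 1 give the expansion the shape that [Lambda_lin]
    and [Lambda_monomial] match. *)
Let hfactorE (S : comPzRingType) (x y c : S) : (x + y) * (x * y - c) =
  y ^+ 1 * x ^+ 2 + 1 * (y ^+ 2 * x ^+ 1) + - c * (y ^+ 0 * x ^+ 1)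
  + - c * (y ^+ 1 * x ^+ 0).
Proof. by ring. Qed.

Let Xhfactor_E (S : comPzRingType) (x y c : S) : x * ((x + y) * (x * y - c)) =
  y ^+ 1 * x ^+ 3 + 1 * (y ^+ 2 * x ^+ 2) + - c * (y ^+ 0 * x ^+ 2)
  + - c * (y ^+ 1 * x ^+ 1).
Proof. by ring. Qed.

Lemma hpolyE b : hpoly b = 'Y ^+ 1 * 'X ^+ 2 + 1%:P%:P * ('Y ^+ 2 * 'X ^+ 1)
  + (- b%:C)%:P%:P * ('Y ^+ 0 * 'X ^+ 1) + (- b%:C)%:P%:P * ('Y ^+ 1 * 'X ^+ 0).
Proof. by rewrite /hpoly hfactorE !polyCN !polyC1. Qed.

Lemma Lambda_hpoly b n omega : (3 <= n)%N ->
  Lambda n omega (hpoly b) = hrow b omega 0 0.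
Proof.
move=> n3; rewrite hpolyE !Lambda_lin !Lambda_monomial /hrow; try lia.
by ring.
Qed.

Lemma Lambda_Xhpoly b n omega : (4 <= n)%N ->
  Lambda n omega ('X * hpoly b) = hrow b omega 0 1.
Proof.
move=> n4; have -> : 'X * hpoly b = 'Y ^+ 1 * 'X ^+ 3 + 1%:P%:P * ('Y ^+ 2 * 'X ^+ 2)
  + (- b%:C)%:P%:P * ('Y ^+ 0 * 'X ^+ 2) + (- b%:C)%:P%:P * ('Y ^+ 1 * 'X ^+ 1).
  by rewrite /hpoly Xhfactor_E !polyCN !polyC1.
rewrite !Lambda_lin !Lambda_monomial /hrow; try lia.
by ring.
Qed.

Lemma charpolys_hpoly b gamma :
  charpolys gamma (hpoly b) <-> forall i j, hrow b gamma i j = 0.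
Proof.
have E i j : \sum_(k < size (hpoly b)) \sum_(l < size (hpoly b)`_k)
    (hpoly b)`_k`_l * gamma (i + l)%N (j + k)%N = hrow b gamma i j.
  rewrite (@charpoly_Lambda 3 (fun l k => gamma (i + l)%N (j + k)%N)).
    by rewrite Lambda_hpoly // /hrow !addn0 !addn1 !addn2.
  move=> k l lk; rewrite hpolyE 3!coef_linXY.
  by rewrite 4?coef_monomialXY_eq0 ?mulr0 ?addr0 //; lia.
split=> H i j; first by rewrite -E H.
by rewrite E H.
Qed.

End Polynomials.

(** * Vanishing of [h] on the zeros of [P] and its effect on moments *)

Section Variety.
Variables (R : realType) (a b : R).
Implicit Types (gamma : nat -> nat -> R[i]) (mu : {measure set (borelC R) -> \bar R}).

(** For [x] and [y] nonzero, divide the real part of the equation by [x] and the imaginary part by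
    [y]; the difference of the quotients is [2 (x^2 + y^2 - b)]. *)
Lemma cubic_zero_h (z : R[i]) : 0 < a + b ->
  z ^+ 3 + a%:C * z + b%:C * z^* = 0 -> (z + z^* ) * (z * z^* - b%:C) = 0.
Proof.
move=> ab0; case: z => x y; rewrite exprS expr2 => /eqP.
rewrite eq_complex /= => /andP[/eqP re /eqP im].
have [x0|x0] := eqVneq x 0.
  by apply/eqP; rewrite eq_complex x0 /=; apply/andP; split; apply/eqP; ring.
have re' : x * x - 3 * (y * y) + (a + b) = 0.
  by apply: (mulfI x0); rewrite mulr0 -[RHS]re; ring.
(* With [y = 0] the real part would give [x^2 = -(a + b) < 0]. *)
have [y0|y0] := eqVneq y 0.
  exfalso; move: re'; rewrite y0; have : 0 < x * x by rewrite -expr2 exprn_even_gt0.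
  by move: ab0; lra.
have im' : 3 * (x * x) - y * y + (a - b) = 0.
  by apply: (mulfI y0); rewrite mulr0 -[RHS]im; ring.
have bE : b = x * x + y * y by lra.
by apply/eqP; rewrite eq_complex bE /=; apply/andP; split; apply/eqP; ring.
Qed.

Lemma has_cintegral_cubic mu gamma i j : (i + j <= 3)%N ->
  (forall i j, (i + j <= 6)%N -> has_cintegral mu (monomial i j) (gamma i j)) ->
  has_cintegral mu
    (fun z => monomial i j z * ((z : R[i]) ^+ 3 + a%:C * z + b%:C * (z : R[i])^* ))
    (gamma i j.+3 + a%:C * gamma i j.+1 + b%:C * gamma i.+1 j).
Proof.
move=> ij rep.
rewrite (_ : (fun z => _) = fun z => monomial i j.+3 z + a%:C * monomial i j.+1 z
    + b%:C * monomial i.+1 j z).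
  by apply: has_cintegralD; [apply: has_cintegralD|];
    try apply: has_cintegralZ; apply: rep; lia.
by apply/funext => z; rewrite /monomial !exprS; move: (z : R[i])^* => zb; ring.
Qed.

Lemma has_cintegral_h mu gamma i j : (i + j <= 3)%N ->
  (forall i j, (i + j <= 6)%N -> has_cintegral mu (monomial i j) (gamma i j)) ->
  has_cintegral mu
    (fun z => monomial i j z *
       (((z : R[i]) + (z : R[i])^* ) * ((z : R[i]) * (z : R[i])^* - b%:C)))
    (hrow b gamma i j).
Proof.
move=> ij rep.
rewrite (_ : (fun z => _) = fun z => monomial i.+1 j.+2 z + monomial i.+2 j.+1 z
    + (- b)%:C * monomial i j.+1 z + (- b)%:C * monomial i.+1 j z).
  rewrite /hrow -!mulNr -!rmorphN.
  do 2![apply: has_cintegralD; last by apply: has_cintegralZ; apply: rep; lia].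
  by apply: has_cintegralD; apply: rep; lia.
by apply/funext => z; rewrite /monomial !exprS rmorphN; move: (z : R[i])^* => zb; ring.
Qed.

Lemma representing_hrow mu gamma : 0 < a + b -> cubic_rec a b gamma ->
  (forall i j, (i + j <= 6)%N -> has_cintegral mu (monomial i j) (gamma i j)) ->
  hrow b gamma 0 0 = 0 /\ hrow b gamma 0 1 = 0.
Proof.
move=> ab0 rec rep.
pose f (z : borelC R) : R[i] := (z : R[i]) ^+ 3 + a%:C * z + b%:C * (z : R[i])^*.
have int0 i j : (i + j <= 3)%N -> has_cintegral mu (fun z => monomial i j z * f z) 0.
  move=> ij; have := has_cintegral_cubic ij rep; rewrite rec.
  by rewrite (_ : _ + _ = 0 :> R[i]) //; ring.
have mf : cmeasurable f.
  have [fi _] := int0 0 0 isT; have := cmeasurable_integrable fi.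
  by under [X in cmeasurable X]eq_fun do rewrite /monomial !expr0 !mul1r.
(* The conjugate of [P] is [zb^3 + a zb + b z], so [|P|^2] is a combination of multiples
   [zb^i z^j P] with [i + j <= 3], each of integral 0. *)
have ff : has_cintegral mu (fun z => f z * (f z)^* ) 0.
  rewrite (_ : (fun z => _) = fun z => monomial 3 0 z * f z
    + a%:C * (monomial 1 0 z * f z) + b%:C * (monomial 0 1 z * f z)); last first.
    apply/funext => z; rewrite /monomial {2}/f !rmorphD !rmorphM /= ?rmorphXn /=.
    rewrite conjCK !conj_real; move: (f z) (z : R[i])^* => fz zb.
    by rewrite expr0 expr1; ring.
  rewrite [X in has_cintegral _ _ X](_ : 0 = 0 + a%:C * 0 + b%:C * 0); last by ring.
  by apply: has_cintegralD; [apply: has_cintegralD|];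
    try apply: has_cintegralZ; apply: int0.
have f0 := has_cintegral_normsq0 mf ff.
suff H i j : (i + j <= 3)%N -> hrow b gamma i j = 0 by split; apply: H.
move=> ij; apply: (has_cintegral_ae0 _ (has_cintegral_h ij rep)).
by apply: filterS f0 => z /(cubic_zero_h ab0) -> /=; rewrite mulr0.
Qed.

End Variety.

(** * Existence of a representing measure with seven atoms *)

Lemma exists_atomic_measure (R : realType) (a b : R)
    (omega gamma : nat -> nat -> R[i]) :
  b < a -> a < 2 * b -> psdmx (moment_mx 3 omega) ->
  (forall i j, (i + j <= 6)%N -> omega i j = gamma i j) ->
  conj_symmetric gamma -> cubic_rec a b gamma -> (forall i j, hrow b gamma i j = 0) ->
  exists mu : {measure set (borelC R) -> \bar R},
    forall i j, has_cintegral mu (monomial i j) (gamma i j).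
Proof.
move=> ba ab psd omE herm rec hz.
(* [b < a] makes [s] positive and [a < 2 b] makes [p] positive, so the seven atoms are distinct. *)
pose p := Num.sqrt (2 * b - a) / 2; pose s := Num.sqrt (a - b).
have p0 : 0 < p by rewrite divr_gt0 // sqrtr_gt0; lra.
have s0 : 0 < s by rewrite sqrtr_gt0; lra.
have p2 : p ^+ 2 = (2 * b - a) / 4.
  by rewrite expr_div_n sqr_sqrtr; [field|lra].
have s2 : s ^+ 2 = a - b by rewrite sqr_sqrtr //; lra.
pose q := Num.sqrt (s ^+ 2 + 3 * p ^+ 2).
have q0 : 0 < q by rewrite sqrtr_gt0 p2 s2; lra.
have pqs : q ^+ 2 = s ^+ 2 + 3 * p ^+ 2 by rewrite sqr_sqrtr // p2 s2; lra.
have aE : a = 2 * s ^+ 2 + 4 * p ^+ 2 by rewrite p2 s2; field.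
have bE : b = s ^+ 2 + 4 * p ^+ 2 by rewrite p2 s2; field.
rewrite bE in hz; rewrite aE bE in rec.
(* By conjugate symmetry, [hrow] at [(0, 0)] is twice the difference of the two sides. *)
have re12 : complex.Re (gamma 1 2) = (s ^+ 2 + 4 * p ^+ 2) * complex.Re (gamma 0 1).
  have := hz 0 0; rewrite /hrow (herm 0 1) (herm 1 2).
  case: (gamma 1 2) (gamma 0 1) => u v [u' v'] /eqP.
  by rewrite eq_complex /= => /andP[/eqP + _]; lra.
have [w [e00 e01 e02 e11 e12]] := atomic_weights p0 q0 s0 pqs herm re12.
have gE : forall i j, gamma i j = atomic_moment p q s w i j.
  apply: (eq_sequence herm rec hz) e00 e01 e02 e11 e12.
  - exact: atomic_moment_conj_sym.
  - exact: atomic_moment_cubic.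
  - exact: atomic_moment_hrow.
have w0 := atomic_weight_ge0 p0 q0 s0 psd
  (fun i j ij => etrans (omE i j ij) (gE i j)).
pose x : nat -> borelC R := node p q s.
(* [atomic_measure] takes a nonnegative weight at every index, while [w0] covers [k < 7] only; the
   absolute value changes none of the seven weights. *)
exists (atomic_measure 7 (fun k => NngNum (normr_ge0 (w k))) x) => i j.
rewrite gE (_ : atomic_moment _ _ _ _ _ _ =
  \sum_(k < 7) (`|w k|)%:C * monomial i j (x k)).
  exact: (has_cintegral_atomic 7 (fun k => NngNum (normr_ge0 (w k))) _
    (cmeasurable_monomial R i j)).
by apply: eq_bigr => k _; rewrite ger0_norm // w0.
Qed.

(** * Column relations of the moment matrix, read entry by entry *)

Section ColumnRelations.
Variables (R : realType) (a b : R).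
Implicit Types omega gamma : nat -> nat -> R[i].

Lemma moment_col_cubic omega :
  moment_col 3 omega 0 3 isT =
    - (a%:C *: moment_col 3 omega 0 1 isT) - b%:C *: moment_col 3 omega 1 0 isT ->
  forall i j, (i + j <= 3)%N ->
    omega i j.+3 = - (a%:C * omega i j.+1) - b%:C * omega i.+1 j.
Proof.
(* Row [(j, i)] of the column relation is the recursion at [(i, j)], whence the exchange of
   indices. *)
move=> col i j; rewrite addnC; move: j i.
have [+ _] := mindex_ind 3 (fun j i =>
  omega i j.+3 = - (a%:C * omega i j.+1) - b%:C * omega i.+1 j).
apply.
have E n (c d : R[i]) (u v : 'cV[R[i]]_n) r :
  (- (c *: u) - d *: v) r 0 = - (c * u r 0) - d * v r 0 by rewrite !mxE.
move=> r; have := congr1 (fun v : 'cV[R[i]]_ _ => v r 0) col.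
by rewrite /= E !moment_colE.
Qed.

Lemma moment_col_h omega :
  moment_col 3 omega 1 2 isT + moment_col 3 omega 2 1 isT
    - b%:C *: moment_col 3 omega 0 1 isT - b%:C *: moment_col 3 omega 1 0 isT = 0
  <-> forall i j, (i + j <= 3)%N -> hrow b omega i j = 0.
Proof.
have E r : (moment_col 3 omega 1 2 isT + moment_col 3 omega 2 1 isT
    - b%:C *: moment_col 3 omega 0 1 isT - b%:C *: moment_col 3 omega 1 0 isT) r 0 =
    hrow b omega (mindex_at r).2 (mindex_at r).1.
  have E n (c : R[i]) (t u v w : 'cV[R[i]]_n) k :
    (t + u - c *: v - c *: w) k 0 = t k 0 + u k 0 - c * v k 0 - c * w k 0.
    by rewrite !mxE.
  by rewrite E !moment_colE.
have [Hr Hk] := mindex_ind 3 (fun j i => hrow b omega i j = 0).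
split=> [col i j|rel].
  rewrite addnC; move: j i; apply: Hr => r.
  by rewrite -E col mxE.
apply/colP => r; rewrite E mxE; move: r; apply: Hk => j i.
by rewrite addnC; exact: rel.
Qed.

(** Induction on the total degree: for [i <= j], either [j < 3] and the value is initial, or
    [i + (j - 3) <= 3] and both families obey the recursion. *)
Lemma rdis_extends omega gamma :
  (forall i j, (i + j <= 6)%N -> (omega i j)^* = omega j i) ->
  (forall i j, (i + j <= 3)%N ->
    omega i j.+3 = - (a%:C * omega i j.+1) - b%:C * omega i.+1 j) ->
  conj_symmetric gamma -> cubic_rec a b gamma ->
  (forall i j, (i <= j)%N -> (j < 3)%N -> gamma i j = omega i j) ->
  forall i j, (i + j <= 6)%N -> omega i j = gamma i j.
Proof.
move=> hermo reco herm rec init.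
suff H n i j : (i <= j)%N -> (i + j <= n)%N -> (i + j <= 6)%N -> omega i j = gamma i j.
  move=> i j ij6; case: (leqP i j) => [ij|/ltnW ji]; first exact: (H 6).
  by rewrite herm -(H 6 j i) // 1?addnC // hermo // addnC.
elim: n i j => [|n IH] i j ij ijn ij6.
  by rewrite init //; lia.
case: (ltnP j 3) => [j3|j3]; first by rewrite init.
have [k jk] : exists k, j = k.+3 by exists (j - 3)%N; lia.
have IH' l m : (l + m <= n)%N -> (l + m <= 6)%N -> omega l m = gamma l m.
  move=> ln l6; case: (leqP l m) => [lm|/ltnW ml]; first exact: IH.
  by rewrite herm -(IH m l) // 1?addnC // hermo // addnC.
by rewrite jk reco ?rec ?IH' //; lia.
Qed.

End ColumnRelations.

Theorem theorem18 (R : realType) (omega : nat -> nat -> R[i]) (a b : R)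
  (omega_herm : forall i j : nat, (i + j <= 6)%N ->
     (omega i j)^* = omega j i)
  (omega00 : 0 < omega 0%N 0%N)
  (M_psd : psdmx (moment_mx 3 omega))
  (* Z^3 = - a Z - b Zb *)
  (M_col : moment_col 3 omega 0 3 isT =
     - (a%:C *: moment_col 3 omega 0 1 isT)
     - b%:C *: moment_col 3 omega 1 0 isT)
  (ltba : b < a) (lta2b : a < 2 * b)
  (h : {poly {poly R[i]}})
  (h_def : h = ('X + 'Y) * ('X * 'Y - b%:C%:P%:P))
  (gamma : nat -> nat -> R[i])
  (gamma_rdis : is_rdis 3 omega
     ('X^3 + a%:C%:P%:P * 'X + b%:C%:P%:P * 'Y) gamma) :
  [<-> (* i *)
       exists mu : {measure set (borelC R) -> \bar R},
         representing_measure (fun i j => (i + j <= 6)%N) omega mu;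
       (* ii *)
       exists mu : {measure set (borelC R) -> \bar R},
         representing_measure (fun _ _ => True) gamma mu;
       (* iii *)
       Lambda 6 omega h = 0 /\ Lambda 6 omega ('X * h) = 0;
       (* iv *)
       complex.Re (omega 1%N 2%N) = b * complex.Re (omega 0%N 1%N) /\
       omega 2%N 2%N = (2 * b * complex.Re (omega 2%N 0%N))%:C
                       + (a + b)%:C * omega 1%N 1%N;
       (* v *)
       charpolys gamma h;
       (* vi *)
       moment_col 3 omega 1 2 isT + moment_col 3 omega 2 1 isT
       - b%:C *: moment_col 3 omega 0 1 isT
       - b%:C *: moment_col 3 omega 1 0 isT = 0].
Proof.
have [herm rec init] := is_rdis_cubic gamma_rdis.
have omE := rdis_extends omega_herm (moment_col_cubic M_col) herm rec init.
have hrowE i j : (i + j <= 3)%N -> hrow b omega i j = hrow b gamma i j.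
  by move=> ij; rewrite /hrow !omE //; lia.
have hE : h = hpoly b by [].
have ab0 : 0 < a + b by lra.
have hrow0 : hrow b gamma 0 0 = 0 /\ hrow b gamma 0 1 = 0 ->
  forall i j, hrow b gamma i j = 0 by case; exact: hrow_eq0.
have rep_hrow mu : representing_measure (fun i j => (i + j <= 6)%N) omega mu ->
    hrow b gamma 0 0 = 0 /\ hrow b gamma 0 1 = 0.
  move=> rep; apply: (representing_hrow ab0 rec (mu := mu)) => i j ij.
  by rewrite -omE //; exact: rep.
(* The first equation is [hrow] at [(0, 0)] halved. In [hrow] at [(0, 1)], reducing [gamma 1 3] by
   [P] and using [gamma 0 2 + gamma 2 0 = 2 Re (gamma 2 0)] gives the second. *)
have iv : (complex.Re (omega 1 2) = b * complex.Re (omega 0 1) /\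
    omega 2 2 = (2 * b * complex.Re (omega 2 0))%:C + (a + b)%:C * omega 1 1) <->
    (hrow b gamma 0 0 = 0 /\ hrow b gamma 0 1 = 0).
  rewrite !omE //.
  have -> : (hrow b gamma 0 0 = 0) =
      (complex.Re (gamma 1 2) = b * complex.Re (gamma 0 1)).
    apply/propext; rewrite /hrow (herm 1 2) (herm 0 1).
    case: (gamma 1 2) (gamma 0 1) => u v [u' v']; split=> [/eqP|/= uE].
      by rewrite eq_complex /= => /andP[/eqP + _]; lra.
    by apply/eqP; rewrite eq_complex uE /=; apply/andP; split; apply/eqP; ring.
  have -> : hrow b gamma 0 1 = gamma 2 2 -
      ((2 * b * complex.Re (gamma 2 0))%:C + (a + b)%:C * gamma 1 1).
    rewrite /hrow rec (herm 2 0).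
    case: (gamma 2 0) (gamma 1 1) (gamma 2 2) => u v [u' v'] [u2 v2].
    by apply/eqP; rewrite eq_complex /=; apply/andP; split; apply/eqP; ring.
  by split=> -[-> /eqP]; [move=> /eqP ->; rewrite subrr|rewrite subr_eq0 => /eqP].
have Lh : Lambda 6 omega h = hrow b gamma 0 0.
  by rewrite hE Lambda_hpoly // hrowE.
have LXh : Lambda 6 omega ('X * h) = hrow b gamma 0 1.
  by rewrite hE Lambda_Xhpoly // hrowE.
rewrite Lh LXh.
tfae.
(* The given measure yields the relations for [h]; the measure for [gamma] is then the atomic
   one. *)
- move=> [mu /rep_hrow/hrow0 h0].
  have [nu nuE] := exists_atomic_measure ltba lta2b M_psd omE herm rec h0.
  by exists nu => i j _; exact: nuE.
- move=> [mu rep]; apply: (rep_hrow mu) => i j ij.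
  by rewrite omE //; exact: rep.
- by move=> ?; apply/iv.
- by move=> /iv/hrow0 ?; rewrite hE; apply/charpolys_hpoly.
- rewrite hE => /charpolys_hpoly h0; apply/moment_col_h => i j ij.
  by rewrite hrowE.
- move=> /moment_col_h h0.
  (* Two entries of the column relation, those for [h] and [z h], already give the whole ideal of
     [h]. *)
  have h0' : forall i j, hrow b gamma i j = 0.
    by apply: hrow0; rewrite -!hrowE // !h0.
  have [nu nuE] := exists_atomic_measure ltba lta2b M_psd omE herm rec h0'.
  by exists nu => i j ij; rewrite omE //; exact: nuE.
Qed.
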